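(* Let $G$ be a locally pseudocompact, connected topological group. Then $G$ satisfies CSP; that is, if $G$ admits a transversal group topology, then either the center $Z(G)$ (with the subspace topology) admits a transversal group topology, or $Z(G)$ is infinite and discrete.
   Context: Two non-discrete Hausdorff group topologies $\tau,\delta$ on a group $G$ are called transversal if their least upper bound $\tau\vee\delta$ is the discrete topology. A topological group $(G,\tau)$ admits a transversal group topology if there is a group topology $\delta$ on $G$ such that $\tau$ and $\delta$ are transversal (in particular $\tau$ is then non-discrete and Hausdorff). A Tychonoff space is pseudocompact if its image under any continuous function to $\mathbb{R}$ is bounded. A topological group is locally pseudocompact if there is a neighborhood $U$ of the neutral element such that $U$ is pseudocompact. $Z(G)$ denotes the center of $G$. CSP abbreviates ''central subgroup paradigm''. *)

(* Defs.v *)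
From HB Require Import structures.
From mathcomp Require Import all_boot all_order all_algebra.
From mathcomp Require Import all_classical all_reals all_analysis.
Import numFieldNormedType.Exports.

Set Implicit Arguments.
Unset Strict Implicit.
Unset Printing Implicit Defensive.

Local Open Scope classical_set_scope.
Local Open Scope group_scope.

HB.mixin Record isTopologicalGroup G & Group G & Topological G := {
  mulg_continuous : continuous (fun x : G * G => x.1 * x.2) ;
  invg_continuous : continuous (fun x : G => x^-1)
}.

#[short(type="topologicalGroupType")]
HB.structure Definition TopologicalGroup :=
  {G of Group G & Topological G & isTopologicalGroup G}.

Section Center.
Variable G : groupType.

Definition center : set G := [set z | forall x : G, z * x = x * z].

(* The alias keeps the group structure below from being attached to set_type
   itself, whose subsets A : set G are arbitrary. *)
Definition center_type : Type := set_type center.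

Lemma center_group_closed : group_closed (fun z : G => z \in center).
Proof.
split=> [|y z]; first by rewrite inE => x; rewrite mul1g mulg1.
rewrite !inE => cy cz x; apply: (mulIg z).
by rewrite -[LHS]mulgA -(cz x) [LHS]mulgA mulgVK -[RHS]mulgA mulgVK cy.
Qed.

HB.instance Definition _ := [isSub of center_type for @sval _ _].
HB.instance Definition _ := [Choice of center_type by <:].
HB.instance Definition _ := SubChoice_isSubGroup.Build
  G (fun z : G => z \in center) center_type center_group_closed.

End Center.

Arguments center : clear implicits.

Section CenterTopologicalGroup.
Variable G : topologicalGroupType.
Local Notation Z := (center_type G).

HB.instance Definition _ := Topological.copy Z (set_type (center G)).

Let val_continuous : continuous (val : Z -> G).
Proof. exact: (@initial_continuous Z G val). Qed.

Lemma center_mulg_continuous : continuous (fun x : Z * Z => x.1 * x.2).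
Proof.
apply/(@continuous_comp_initial Z (Z * Z)%type G val) => x.
apply: (@continuous_comp _ _ _ (fun x : Z * Z => (val x.1, val x.2))
  (fun y : G * G => y.1 * y.2)); last exact: mulg_continuous.
apply: cvg_pair; apply: continuous_comp.
- exact: cvg_fst.
- exact: val_continuous.
- exact: cvg_snd.
- exact: val_continuous.
Qed.

Lemma center_invg_continuous : continuous (fun x : Z => x^-1).
Proof.
apply/(@continuous_comp_initial Z Z G val) => x.
apply: (@continuous_comp _ _ _ (val : Z -> G) (fun y : G => y^-1)).
  exact: val_continuous.
exact: invg_continuous.
Qed.

HB.instance Definition _ := isTopologicalGroup.Build Z
  center_mulg_continuous center_invg_continuous.

End CenterTopologicalGroup.

Definition discrete_space (T : topologicalType) := forall A : set T, open A.

(* In a structure t : Topological T, only the topology matters: its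
   choiceType component is not used to form the propositions below. *)
Definition group_topology (G : groupType) (t : Topological G) :=
  let Gt := Topological.Pack t in
  continuous ((fun x => x.1 * x.2) : Gt * Gt -> Gt) /\
  continuous ((fun x => x^-1) : Gt -> Gt).

Definition join_topology (G : groupType) (s t : Topological G) :
    topologicalType :=
  sup_topology (fun b : bool => if b then s else t).

Definition nondiscrete_hausdorff (T : topologicalType) :=
  hausdorff_space T /\ ~ discrete_space T.

Definition transversal_topologies (G : groupType) (s t : Topological G) :=
  [/\ group_topology s, nondiscrete_hausdorff (Topological.Pack s),
      group_topology t, nondiscrete_hausdorff (Topological.Pack t)
    & discrete_space (join_topology s t)].

Definition admits_transversal (G : topologicalGroupType) :=
  exists t : Topological G,
    transversal_topologies (Topological.class G) t.

Definition CSP (G : topologicalGroupType) :=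
  admits_transversal G ->
  admits_transversal (center_type G) \/
  infinite_set [set: center_type G] /\ discrete_space (center_type G).

Definition tychonoff_space (T : topologicalType) :=
  hausdorff_space T /\ completely_regular_space T.

Definition pseudocompact (R : realType) (T : topologicalType) :=
  tychonoff_space T /\
  forall f : T -> R, continuous f -> bounded_set (range f).

Definition locally_pseudocompact (R : realType) (G : topologicalGroupType) :=
  exists2 U : set G, nbhs 1 U & pseudocompact R (set_type U).

(* Main.v *)
Require Import Defs.
From mathcomp Require Import all_boot all_order all_algebra.
From mathcomp Require Import all_classical all_reals all_analysis.
Import Order.TTheory GRing.Theory Num.Theory numFieldNormedType.Exports.

(** Let [t] be transversal to the topology tau of [G]: some tau-neighbourhood
[A] and some [t]-neighbourhood [B] of 1 meet only in 1. The idea is that this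
forces a [t]-neighbourhood of 1 to be countable, after which a category argument
for tau traps a [t]-neighbourhood of 1 inside the center.

A pseudocompact Tychonoff space is feebly compact: a sequence of nonempty open
sets accumulates somewhere ([pseudocompact_feebly_compact]). Applied to a
pseudocompact tau-neighbourhood [U] of 1, this gives two things. First, [U] is
covered by finitely many translates of any neighbourhood of 1, and connectedness
spreads this to a countable cover of [G] ([connected_omega_narrow]). Second, [G]
is not a countable union of closed sets with empty interior
([feebly_compact_baire]).

Choose [W] and [V] with [W^-1 W] inside [A] and [V^-1 V] inside [B]. Each
translate of [W] then contains at most one point of [V], so [V] is countable
([transversal_countable]). For [g] in [V] not central and [w] in [V], the set of
[x] with [g ^ x = w] is tau-closed and, being a coset of the centralizer of [g],
it has empty interior: otherwise the centralizer would be an open subgroup of a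
connected group. There are countably many pairs [(g, w)], so some [x] avoids all
these sets. Conjugation by [x] is [t]-continuous, so every [g] in [V] close
enough to 1 for [t] satisfies [g ^ x \in V], and therefore is central
([transversal_open_center]).

Thus the center is a [t]-neighbourhood of 1. As [t] is Hausdorff and not
discrete, its trace on the center is not discrete either, and so the center is
infinite. If the tau-topology of the center is not discrete, the trace of [t] is
transversal to it; otherwise the center is infinite and discrete. *)

Set Implicit Arguments.
Unset Strict Implicit.
Unset Printing Implicit Defensive.

Local Open Scope classical_set_scope.

(** * Pseudocompactness and accumulation of open sets *)

Section FeebleCompactness.
Local Open Scope ring_scope.

(** Place on [O n] a bump of height [n] at one of its points: by local
finiteness the sum of the bumps is continuous, and it takes arbitrarily large values. *)
Lemma locally_finite_unbounded (R : realType) (X : topologicalType)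
    (O : nat -> set X) :
  @completely_regular_space X ->
  (forall n, open (O n)) -> (forall n, O n !=set0) ->
  (forall x : X, exists N, nbhs x [set y | forall n, (N <= n)%N -> ~ O n y]) ->
  exists2 f : X -> R, continuous f & ~ bounded_set (range f).
Proof.
move=> crX oO /choice[a Oa] /choice[N N_nbhs].
have bump n : exists h : X -> R, [/\ continuous h, forall y, 0 <= h y,
    h (a n) = n%:R & forall y, ~ O n y -> h y = 0].
  have clO : closed (~` O n) by rewrite closedC.
  have nOa : ~ (~` O n) (a n) by apply; exact: Oa.
  have /(@uniform_separatorP _ R)[f [cf f01 f0 f1]] := crX (a n) _ clO nOa.
  exists (fun y => n%:R * (1 - f y)); split.
  - move=> y; apply: cvgM; first exact: cvg_cst.
    by apply: cvgB; [exact: cvg_cst|exact: cf].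
  - move=> y; apply: mulr_ge0 => //; rewrite subr_ge0.
    by have /= := f01 _ (imageT f y); rewrite in_itv /= => /andP[].
  - by rewrite [f _]f0 ?subr0 ?mulr1//; exists (a n).
  - by move=> y nOy; rewrite [f _]f1 ?subrr ?mulr0//; exists y.
have {bump} [h hP] := choice bump.
pose S m y := \sum_(i < m) h i y.
have NS x m y : (forall n, (N x <= n)%N -> ~ O n y) -> (N x <= m)%N ->
    S m y = S (N x) y.
  move=> nO; elim: m => [|m IH]; first by rewrite leqn0 => /eqP ->.
  rewrite leq_eqVlt => /predU1P[->//|lt_m].
  rewrite /S big_ord_recr /= -/(S m y) IH //.
  by have [_ _ _ ->] := hP m; rewrite ?addr0//; exact: nO.
have NP x : forall n, (N x <= n)%N -> ~ O n x := nbhs_singleton (N_nbhs x).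
(* Near [x] all bumps of index at least [N x] vanish, so the infinite sum can be
   read off as a partial sum whose length depends on the point. *)
pose f x := S (N x) x.
have fE x y : (forall n, (N x <= n)%N -> ~ O n y) -> f y = S (N x) y.
  move=> nO; rewrite -(NS x (maxn (N x) (N y))) ?leq_maxl //.
  by rewrite (NS y) ?leq_maxr //; exact: NP.
have cS m : continuous (S m).
  elim: m => [|m IH] x.
    rewrite (_ : S 0%N = cst 0); first exact: cvg_cst.
    by apply/funext => y; rewrite /S big_ord0.
  rewrite (_ : S m.+1 = fun y => S m y + h m y).
    by apply: cvgD; [exact: IH|have [ch _ _ _] := hP m; exact: ch].
  by apply/funext => y; rewrite /S big_ord_recr.
exists f.
  move=> x; rewrite /continuous_at (fE x x (NP x)).
  apply: (cvg_trans _ (cS (N x) x)); apply: near_eq_cvg.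
  by apply: filterS (N_nbhs x) => y /(fE x).
move=> [M0 [_ /(_ (M0 + 1))]]; rewrite ltrDl ltr01 => /(_ isT).
set M := M0 + 1 => bM; pose n := (Num.trunc M).+1.
have : `|f (a n)| <= M by apply: bM; exists (a n).
have SP m : 0 <= S m (a n) by apply: sumr_ge0 => i _; have [_ + _ _] := hP i.
rewrite ger0_norm ?SP// leNgt => /negP; apply.
apply: (lt_le_trans (truncnS_gt M)).
have nN : (n < N (a n))%N.
  by rewrite ltnNge; apply/negP => /NP; apply; exact: Oa.
rewrite /f /S (bigD1 (Ordinal nN)) //=; have [_ _ -> _] := hP n.
rewrite -/n lerDl; apply: sumr_ge0 => i _.
by have [_ + _ _] := hP i.
Qed.

(** For [U] with the subspace topology, this says that a locally finite family
of nonempty open sets is finite; the open sets are taken in the ambient space so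
that the notion can be used without passing to a subtype. *)
Definition feebly_compact (T : topologicalType) (U : set T) :=
  forall O : nat -> set T,
    (forall n, open (O n)) -> (forall n, U `&` O n !=set0) ->
  exists2 x, U x &
    forall W, nbhs x W -> forall N, exists n, (N <= n)%N /\ W `&` O n !=set0.

Lemma pseudocompact_feebly_compact (R : realType) (T : topologicalType)
    (U : set T) : pseudocompact R (set_type U) -> feebly_compact U.
Proof.
move=> [[_ crU] pcU] O oO O0; apply: contrapT => noacc.
pose O' n : set (set_type U) := set_val @^-1` O n.
have [||x|f cf] := @locally_finite_unbounded R _ O' crU.
- by move=> n; exists (O n).
- move=> n; have [x [Ux Ox]] := O0 n.
  by exists (SigSub (mem_set Ux)); rewrite /O'/= set_valE.
- apply: contrapT => xP; apply: noacc; exists (set_val x).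
    exact: set_valP.
  move=> W Wx N; apply: contrapT => nW; apply: xP; exists N.
  have : nbhs x (set_val @^-1` W) by exact: initial_continuous.
  apply: filterS => y Wy n Nn Oy; apply: nW; exists n; split=> //.
  by exists (set_val y).
- by apply; exact: pcU.
Qed.

End FeebleCompactness.

(** * Neighbourhoods in a group topology *)

(** The group [G] carries several topologies at once, so these facts are stated
for an explicit topology [t] on the carrier. *)
Section GroupTopology.
Local Open Scope group_scope.
Variables (G : groupType) (t : Topological G).
Hypothesis tG : group_topology t.
Local Notation Gt := (Topological.Pack t).

Lemma cvg_mulg (T : Type) (F : set_system T) {FF : Filter F} (f g : T -> G)
    (a b : G) : f @ F --> (a : Gt) -> g @ F --> (b : Gt) ->
  (fun x => f x * g x) @ F --> (a * b : Gt).
Proof.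
move=> fa gb; have [mulG _] := tG.
apply: (@cvg_comp _ _ _ (fun x => (f x, g x) : Gt * Gt)
  (fun x : Gt * Gt => (x.1 : G) * x.2) F (nbhs ((a, b) : Gt * Gt))).
  exact: (@cvg_pair _ Gt Gt F (nbhs (a : Gt)) (nbhs (b : Gt)) FF _ _ f g fa gb).
exact: (mulG (a, b)).
Qed.

Lemma cvg_invg (T : Type) (F : set_system T) {FF : Filter F} (f : T -> G)
    (a : G) : f @ F --> (a : Gt) -> (fun x => (f x)^-1) @ F --> (a^-1 : Gt).
Proof.
by move=> fa; have [_ invG] := tG; apply: cvg_comp fa _; exact: (invG a).
Qed.

Lemma nbhs1_mull (x : G) (A : set G) :
  nbhs (x : Gt) A -> nbhs (1 : Gt) [set u | A (x * u)].
Proof.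
have : (fun u => x * u) @ (nbhs (1 : Gt)) --> (x * 1 : Gt).
  by apply: cvg_mulg; [exact: (@cvg_cst Gt)|exact: cvg_id].
by rewrite mulg1 => h /h.
Qed.

Lemma nbhs1_mulr (x : G) (A : set G) :
  nbhs (x : Gt) A -> nbhs (1 : Gt) [set u | A (u * x)].
Proof.
have : (fun u => u * x) @ (nbhs (1 : Gt)) --> (1 * x : Gt).
  by apply: cvg_mulg; [exact: cvg_id|exact: (@cvg_cst Gt)].
by rewrite mul1g => h /h.
Qed.

Lemma nbhs_translate (x : G) (W : set G) :
  nbhs (1 : Gt) W -> nbhs (x : Gt) [set y | W (x^-1 * y)].
Proof.
have : (fun y => x^-1 * y) @ (nbhs (x : Gt)) --> (x^-1 * x : Gt).
  by apply: cvg_mulg; [exact: (@cvg_cst Gt)|exact: cvg_id].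
by rewrite mulVg => h /h.
Qed.

Lemma nbhs_translateV (x : G) (W : set G) :
  nbhs (1 : Gt) W -> nbhs (x : Gt) [set y | W (y^-1 * x)].
Proof.
have : (fun y => y^-1 * x) @ (nbhs (x : Gt)) --> (x^-1 * x : Gt).
  by apply: cvg_mulg; [apply: cvg_invg; exact: cvg_id|exact: (@cvg_cst Gt)].
by rewrite mulVg => h /h.
Qed.

Lemma cvg_conjg (T : Type) (F : set_system T) {FF : Filter F} (f g : T -> G)
    (a b : G) : f @ F --> (a : Gt) -> g @ F --> (b : Gt) ->
  (fun x => f x ^ g x) @ F --> (a ^ b : Gt).
Proof.
by move=> fa gb; do !apply: cvg_mulg => //; exact: cvg_invg.
Qed.

Lemma nbhs1_split (V : set G) : nbhs (1 : Gt) V ->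
  exists W, [/\ nbhs (1 : Gt) W, forall x, W x -> W x^-1
    & forall x y, W x -> W y -> V (x * y)].
Proof.
move=> V1; have [mulG _] := tG.
have [[A B]/= [A1 B1] AB] : nbhs ((1, 1) : Gt * Gt)
    [set x : Gt * Gt | V ((x.1 : G) * x.2)].
  by apply: (mulG (1, 1)); rewrite mulg1.
have I1 : nbhs (1 : Gt) [set x : G | (A `&` B) x^-1].
  have : (fun u => u^-1) @ (nbhs (1 : Gt)) --> (1^-1 : Gt).
    by apply: cvg_invg; exact: cvg_id.
  by rewrite invg1 => h; apply: h; exact: filterI.
exists ((A `&` B) `&` [set x | (A `&` B) x^-1]); split.
- by apply: filterI => //; exact: filterI.
- by move=> x [xAB xIAB]; split=> //=; rewrite invgK.
- by move=> x y [[Ax _] _] [[_ By] _]; exact: (AB (x, y)).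
Qed.

Lemma nbhs1_div (V : set G) : nbhs (1 : Gt) V ->
  exists2 W, nbhs (1 : Gt) W & forall x y, W x -> W y -> V (x^-1 * y).
Proof.
move=> /nbhs1_split[W [W1 WV WM]]; exists W => // x y Wx Wy.
by apply: WM => //; exact: WV.
Qed.

(** A topological group is a regular space. *)
Lemma nbhs_closure_sub (x : G) (A : set G) : nbhs (x : Gt) A ->
  exists2 B : set Gt, open_nbhs (x : Gt) B & closure B `<=` A.
Proof.
move=> /nbhs1_mull/nbhs1_split[W [W1 WV WM]].
exists (interior ([set y | W (x^-1 * y)] : set Gt)).
  split; first exact: open_interior.
  exact: nbhs_translate.
move=> y /(_ _ (nbhs_translateV y W1)) [z [/interior_subset/= xz]] /= zy.
by have /= := WM _ _ xz zy; rewrite !mulgA mulgV mul1g mulgV mul1g.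
Qed.

End GroupTopology.

(** * Connected groups with a feebly compact neighbourhood of the identity *)

Section TopologicalGroupType.
Local Open Scope group_scope.
Variable G : topologicalGroupType.

Lemma group_topology_class : group_topology (Topological.class G).
Proof. by split; [exact: mulg_continuous|exact: invg_continuous]. Qed.
Local Notation tG := group_topology_class.

(** If right translation by a neighbourhood of 1 preserves [A], then [A] is open,
and it is also closed. The set [A] need not be a subgroup: it will be a union of
translates of a neighbourhood of 1 as well as a centralizer. *)
Lemma connected_mul_stable (A W : set G) : connected [set: G] ->
  nbhs 1 W -> A !=set0 -> (forall a w, A a -> W w -> A (a * w)) ->
  forall x, A x.
Proof.
move=> cG W1 A0 AW x.
have [S [S1 SV SM]] := nbhs1_split tG W1.
have WS s : S s -> W s.
  by move=> Ss; have := SM _ _ Ss (nbhs_singleton S1); rewrite mulg1.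
have oA : open A.
  rewrite openE => a Aa; apply: filterS (nbhs_translate tG a S1) => y /WS.
  by move=> /(AW _ _ Aa); rewrite mulVKg.
have clA : closed A.
  move=> y /(_ _ (nbhs_translateV tG y S1)) [a [Aa /WS]].
  by move=> /(AW _ _ Aa); rewrite mulVKg.
have -> : A = setT; last by [].
by apply: cG => //; exists A; rewrite ?setTI.
Qed.

Lemma connected_nbhs_centralizer (g : G) : connected [set: G] ->
  nbhs 1 [set u : G | commute g u] -> Defs.center G g.
Proof.
move=> cG C1 x.
apply: (connected_mul_stable (A := [set u | commute g u]) cG C1)
  => [|a w ga gw].
  by exists 1; rewrite /= /commute mulg1 mul1g.
by rewrite /= /commute mulgA ga -mulgA gw mulgA.
Qed.

(** Otherwise one picks points of [U] outside the finitely many translates of [W]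
by the previous ones; small neighbourhoods of these points form a family of open
sets which is locally finite, because a small neighbourhood of any point meets
at most one of them. *)
Lemma feebly_compact_totally_bounded (U W : set G) :
  feebly_compact U -> nbhs 1 W ->
  exists s : seq G, forall x, U x -> exists2 e, e \in s & W (e^-1 * x).
Proof.
move=> fcU W1; apply: contrapT => noS.
have /choice[c cP] (s : seq G) : exists x, U x /\
    forall e, e \in s -> ~ W (e^-1 * x).
  apply: contrapT => nx; apply: noS; exists s => x Ux.
  apply: contrapT => nW; apply: nx; exists x; split=> // e es We.
  by apply: nW; exists e.
pose xs n := iter n (fun s => rcons s (c s)) [::].
pose x n := c (xs n).
have xs_mem m n : (m < n)%N -> x m \in xs n.
  elim: n => // n IH; rewrite ltnS leq_eqVlt /= mem_rcons inE => /predU1P[->|].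
    by rewrite eqxx.
  by move=> /IH ->; rewrite orbT.
have [S [S1 SV SM]] := nbhs1_split tG W1.
have [D D1 DM] := nbhs1_div tG S1.
pose O n : set G := interior [set y | D (y^-1 * x n)].
have [| |p Up acc] := fcU O.
- by move=> n; exact: open_interior.
- move=> n; exists (x n); split; first by have [] := cP (xs n).
  exact: (nbhs_translateV tG).
have pD := nbhs_translateV tG p D1.
have [m [_ [y [/= yp /interior_subset/= ym]]]] := acc _ pD 0%N.
have [n [mn [z [/= zp /interior_subset/= zn]]]] := acc _ pD m.+1.
have [_ /(_ _ (xs_mem _ _ mn))] := cP (xs n); apply.
have := SM _ _ (DM _ _ ym yp) (DM _ _ zp zn).
by rewrite !invgM !invgK -!mulgA !mulVKg.
Qed.

(** Let [S S] lie in [U], let [s] be a finite set such that [U] lies in [s S], and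
let [D] be the countable set of products of elements of [s]. Then
[D S S] lies in [D U], hence in [D s S = D S], so that [D S] is the whole
group. *)
Lemma connected_omega_narrow (U W : set G) : connected [set: G] ->
  nbhs 1 U -> feebly_compact U -> nbhs 1 W ->
  exists e : nat -> G, forall x, exists n, W ((e n)^-1 * x).
Proof.
move=> cG U1 fcU W1.
have [S [S1 _ SM]] := nbhs1_split tG U1.
have [s sP] := feebly_compact_totally_bounded fcU S1.
have [r rP] := feebly_compact_totally_bounded fcU W1.
pose d (l : seq nat) := foldl (fun a i => a * nth 1 s i) 1 l.
have dP x : exists l, S ((d l)^-1 * x).
  apply: (@connected_mul_stable [set x | exists l, S ((d l)^-1 * x)] S) => //.
    by exists 1, [::]; rewrite /d /= invg1 mulg1; exact: nbhs_singleton S1.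
  move=> a w [l la] Sw; have [e es Se] := sP _ (SM _ _ la Sw).
  exists (rcons l (index e s)).
  rewrite /= /d foldl_rcons nth_index// -/(d l) invgM.
  by move: Se; rewrite -!mulgA.
pose e n := if unpickle n is Some (l, i) then d l * nth 1 r i else 1.
exists e => x; have [l lx] := dP x.
have /rP[f fr Wf] : U ((d l)^-1 * x).
  by have := SM _ _ lx (nbhs_singleton S1); rewrite mulg1.
exists (pickle (l, index f r)); rewrite /e pickleK nth_index//.
by rewrite invgM -mulgA.
Qed.

(** The usual nested sequence of open sets, each with its closure inside the
previous one and away from one more [F i]; feeble compactness of [U] takes the
place of completeness in providing a point of the intersection. *)
Lemma feebly_compact_baire (U : set G) (I : countType) (F : I -> set G) :
  nbhs 1 U -> feebly_compact U -> (forall i, closed (F i)) ->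
  (forall i O, open O -> O !=set0 -> ~ O `<=` F i) ->
  exists x, forall i, ~ F i x.
Proof.
move=> U1 fcU clF ndF.
have stepP (nO : nat * set G) : exists B : set G, open nO.2 -> nO.2 !=set0 ->
    [/\ open B, B !=set0, closure B `<=` nO.2
      & forall i, unpickle nO.1 = Some i -> closure B `<=` ~` F i].
  case: nO => n O /=.
  have [[oO O0]|] := pselect (open O /\ O !=set0); last first.
    by move=> nO; exists set0 => oO O0; case: nO.
  have [A [oA [x Ax] AO AF]] : exists A : set G, [/\ open A, A !=set0,
      A `<=` O & forall i, unpickle n = Some i -> A `<=` ~` F i].
    case: (unpickle n) => [i|]; last by exists O; split.
    exists (O `&` ~` F i); split => //.
    - by apply: openI => //; rewrite openC.
    - apply: contrapT => OF0; apply: (ndF i O) => // x Ox.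
      by apply: contrapT => nF; apply: OF0; exists x.
    - by move=> j [<-] x [].
  have [|B [oB Bx] BA] := @nbhs_closure_sub _ _ tG x A.
    exact: open_nbhs_nbhs.
  exists B => _ _; split=> //; first by exists x.
    exact: subset_trans BA _.
  by move=> i /AF; exact: subset_trans.
have [step {}stepP] := choice stepP.
(* Stage [n] avoids the set whose index has code [n], if there is one. *)
pose O := fix O n := if n is m.+1 then step (m, O m) else interior U.
have OP n : open (O n) /\ O n !=set0.
  elim: n => [|n [oO O0]] /=.
    by split; [exact: open_interior|exists 1].
  by have [] := stepP (n, O n) oO O0.
have clO n : closure (O n.+1) `<=` O n.
  by have [oO O0] := OP n; have [] := stepP (n, O n) oO O0.
have decO m n : (m <= n)%N -> O n `<=` O m.
  elim: n => [|n IH]; first by rewrite leqn0 => /eqP ->.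
  rewrite leq_eqVlt => /predU1P[->//|/IH]; apply: subset_trans.
  by apply: subset_trans (clO n); exact: subset_closure.
have [n|n|x Ux acc] := fcU O.
- by have [] := OP n.
- have [_ [y Oy]] := OP n; exists y; split=> //.
  exact: interior_subset (decO 0%N n (leq0n n) y Oy).
exists x => i.
have xO n : closure (O n) x.
  move=> W /acc/(_ n)[m [nm [y [Wy /(decO _ _ nm) Oy]]]].
  by exists y.
have [oO O0] := OP (pickle i).
have [_ _ _ /(_ i (pickleK i))] := stepP (pickle i, O (pickle i)) oO O0.
by apply; exact: (xO (pickle i).+1).
Qed.

End TopologicalGroupType.

(** * The join of two group topologies *)

Lemma discrete_nbhsP (T : topologicalType) :
  discrete_space T <-> forall x : T, nbhs x [set x].
Proof.
split=> [dT x|dT A]; first by apply: open_nbhs_nbhs; split => //; exact: dT.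
by rewrite openE => x Ax; apply: filterS (dT x) => _ ->.
Qed.

Section Join.
Local Open Scope group_scope.
Variable G : groupType.

Lemma join_nbhs (s t : Topological G) (x : G) (A B : set G) :
  nbhs (x : Topological.Pack s) A -> nbhs (x : Topological.Pack t) B ->
  nbhs (x : join_topology s t) (A `&` B).
Proof.
move=> sA tB.
have jst : forall b : bool, nbhs (x : join_topology s t) -->
    nbhs (x : Topological.Pack (if b then s else t)).
  by apply/cvg_sup; exact: cvg_id.
by apply: filterI; [exact: (jst true A sA)|exact: (jst false B tB)].
Qed.

Lemma join_nbhs_ex (s t : Topological G) (x : G) (C : set G) :
  nbhs (x : join_topology s t) C ->
  exists A B, [/\ nbhs (x : Topological.Pack s) A,
    nbhs (x : Topological.Pack t) B & A `&` B `<=` C].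
Proof.
(* It suffices that the filter of the sets [C] of this form converges. *)
pose F : set_system G := [set C | exists A B,
  [/\ nbhs (x : Topological.Pack s) A, nbhs (x : Topological.Pack t) B
    & A `&` B `<=` C]].
have FF : Filter F.
  split.
  - by exists setT, setT; split => //; exact: filterT.
  - move=> P Q [A [B [sA tB AB]]] [A' [B' [sA' tB' AB']]].
    exists (A `&` A'), (B `&` B'); split; [exact: filterI|exact: filterI|].
    by move=> y [[? ?] [? ?]]; split; [exact: AB|exact: AB'].
  - move=> P Q PQ [A [B [sA tB AB]]]; exists A, B; split=> //.
    exact: subset_trans AB PQ.
suff : F --> (x : join_topology s t) by apply.
apply/cvg_sup => -[] A xA.
  by exists A, setT; split; [by []|exact: filterT|move=> y []].
by exists setT, A; split; [exact: filterT|by []|move=> y []].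
Qed.

Lemma discrete_nbhs1 (t : Topological G) : group_topology t ->
  nbhs (1 : Topological.Pack t) [set 1] -> discrete_space (Topological.Pack t).
Proof.
move=> tG t1; apply/discrete_nbhsP => x.
apply: filterS (nbhs_translate tG x t1) => y /= /mulg1_eq.
by rewrite invgK.
Qed.

Lemma discrete_join (s t : Topological G) :
  group_topology s -> group_topology t ->
  (exists A B, [/\ nbhs (1 : Topological.Pack s) A,
     nbhs (1 : Topological.Pack t) B & A `&` B `<=` [set 1]]) ->
  discrete_space (join_topology s t).
Proof.
move=> sG tG [A [B [sA tB AB]]]; apply/discrete_nbhsP => x.
apply: filterS (join_nbhs (nbhs_translate sG x sA) (nbhs_translate tG x tB)).
move=> y /AB /= /mulg1_eq.
by rewrite invgK.
Qed.

End Join.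

(** * The center is a neighbourhood of 1 in a transversal topology *)

Section Center.
Local Open Scope group_scope.
Variable G : topologicalGroupType.

(** Two points of the fibre [g ^ x = w] differ by an element of the centralizer
of [g], so a fibre with interior makes this centralizer open. *)
Lemma connected_conjg_fiber (g w : G) (O : set G) : connected [set: G] ->
  open O -> O !=set0 -> O `<=` [set x | g ^ x = w] -> Defs.center G g.
Proof.
move=> cG oO [x Ox] Ow; apply: connected_nbhs_centralizer => //.
have Ox1 := nbhs1_mulr (group_topology_class G) (open_nbhs_nbhs (conj oO Ox)).
apply: filterS Ox1 => u /Ow /=; rewrite -(Ow x Ox) conjgM => /conjg_inj.
by move=> gu; rewrite /= /commute (conjgC g u) gu.
Qed.

(** A translate of a small [W] contains at most one point of a small [V], and
countably many translates of [W] cover the group. *)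
Lemma transversal_countable (t : Topological G) (U : set G) :
  connected [set: G] -> nbhs 1 U -> feebly_compact U ->
  transversal_topologies (Topological.class G) t ->
  exists2 V, nbhs (1 : Topological.Pack t) V &
    exists h : nat -> G, V `<=` range h.
Proof.
move=> cG U1 fcU [tauG _ tG _ /discrete_nbhsP/(_ (1 : G))].
move=> /join_nbhs_ex[A [B [A1 B1 AB]]].
have [W W1 WA] := nbhs1_div tauG A1.
have [V V1 VB] := nbhs1_div tG B1.
have [e eP] := connected_omega_narrow cG U1 fcU W1.
(* [P n] has at most one element; 1 is a dummy value when it has none. *)
pose P n := [set v | V v /\ W ((e n)^-1 * v)].
exists V => //; exists (fun n => xget 1 (P n)) => v Vv.
have [n Wv] := eP v; exists n => //.
have [Vx Wx] : P n (xget 1 (P n)) by apply: (xgetPex 1); exists v.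
apply/esym; set x := xget _ _ in Vx Wx *.
have /AB : (A `&` B) (x^-1 * v).
  split; last exact: VB.
  by have := WA _ _ Wx Wv; rewrite invgM invgK -mulgA mulVKg.
by move=> /= /mulg1_eq; rewrite invgK.
Qed.

Lemma transversal_open_center (t : Topological G) (U : set G) :
  connected [set: G] -> nbhs 1 U -> feebly_compact U ->
  transversal_topologies (Topological.class G) t ->
  nbhs (1 : Topological.Pack t) (Defs.center G).
Proof.
move=> cG U1 fcU tr; have [tauG [tauH _] tG _ _] := tr.
have [V V1 [h Vh]] := transversal_countable cG U1 fcU tr.
(* Putting the centrality condition inside the fibre makes it empty, hence
   harmless for the category argument, when [h p.1] is central. *)
pose F (p : nat * nat) :=
  [set x | ~ Defs.center G (h p.1) /\ h p.1 ^ x = h p.2].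
have [p|p O oO O0 OF|x xF] := feebly_compact_baire U1 fcU (F := F).
- have [c|nc] := pselect (Defs.center G (h p.1)).
    rewrite (_ : F p = set0); first exact: closed0.
    by rewrite -subset0 => x [].
  rewrite (_ : F p = (fun x => h p.1 ^ x) @^-1` [set h p.2]); last first.
    by apply/seteqP; split => x //= [].
  apply: preimage_closed; last first.
    exact/accessible_closed_set1/hausdorff_accessible.
  move=> x _; apply: (cvg_conjg tauG); [exact: (@cvg_cst G)|exact: cvg_id].
- have [x /OF[nc _]] := O0; apply: nc.
  apply: (connected_conjg_fiber (w := h p.2) cG oO O0).
  by move=> y /OF[].
- have : nbhs (1 : Topological.Pack t) [set g | V (g ^ x)].
    have : (fun g => g ^ x) @ (nbhs (1 : Topological.Pack t)) -->
        (1 ^ x : Topological.Pack t).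
      apply: (cvg_conjg tG); first exact: cvg_id.
      exact: (@cvg_cst (Topological.Pack t)).
    by rewrite conj1g => /(_ V V1).
  move=> Vx1; apply: filterS (filterI V1 Vx1) => g [/Vh[i _ <-]] /Vh[j _ ij].
  by apply: contrapT => nc; apply: (xF (i, j)).
Qed.

End Center.

(** * Group topologies pulled back along a homomorphism *)

Lemma hausdorff_initial (S : choiceType) (T : topologicalType) (f : S -> T) :
  injective f -> hausdorff_space T -> hausdorff_space (initial_topology f).
Proof.
move=> finj hT x y xy; apply: finj; apply: hT => A B Ax By.
have [z [Az Bz]] := xy _ _ (initial_continuous Ax) (initial_continuous By).
by exists (f z).
Qed.

Section InitialGroupTopology.
Local Open Scope group_scope.
Variables (H K : groupType) (f : H -> K) (t : Topological K).

(** Repackaged on the carrier of [H], because the alias on which the initial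
topology lives has no group structure. *)
Definition initial_group_topology : Topological H :=
  Topological.class (initial_topology (f : H -> Topological.Pack t)).

Lemma group_topology_initial :
  {morph f : x y / x * y >-> x * y} -> {morph f : x / x^-1 >-> x^-1} ->
  group_topology t -> group_topology initial_group_topology.
Proof.
move=> fM fV tG; set W : topologicalType :=
  initial_topology (f : H -> Topological.Pack t).
have cf : continuous (f : W -> Topological.Pack t) by exact: initial_continuous.
split.
  apply: (@continuous_comp_initial _ (W * W)%type _
    (f : H -> Topological.Pack t)).
  move=> x; rewrite /continuous_at /= fM.
  rewrite (_ : _ \o _ = fun x : W * W => f x.1 * f x.2); last first.
    by apply/funext => y; exact: fM.
  apply: (cvg_mulg tG).
    by apply: (@cvg_comp _ _ _ fst f _ (nbhs x.1) _ _ (cf _)); exact: cvg_fst.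
  by apply: (@cvg_comp _ _ _ snd f _ (nbhs x.2) _ _ (cf _)); exact: cvg_snd.
apply: (@continuous_comp_initial _ W _ (f : H -> Topological.Pack t)).
move=> x; rewrite /continuous_at /= fV.
rewrite (_ : _ \o _ = fun x : W => (f x)^-1); last first.
  by apply/funext => y; exact: fV.
exact: (cvg_invg tG (cf x)).
Qed.

End InitialGroupTopology.

(** * The central subgroup paradigm *)

Theorem theorem3p2 (R : realType) (G : topologicalGroupType)
    (hpc : locally_pseudocompact R G) (hconn : connected [set: G]) :
  CSP G.
Proof.
move=> [t tr]; have [U U1 /pseudocompact_feebly_compact fcU] := hpc.
have Zt := transversal_open_center hconn U1 fcU tr.
have [tauG [tauH _] tG [tH tnd] /discrete_nbhsP/(_ (1%g : G)) tauxt] := tr.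
pose i := val : center_type G -> G.
pose tZ := initial_group_topology i t.
have iinj : injective i by exact: val_inj.
have tZG : group_topology tZ by apply: group_topology_initial.
have tZH : hausdorff_space (Topological.Pack tZ) by apply: hausdorff_initial.
(* A [t]-open set tracing {1} on the center, cut down to the center, would be
   a [t]-neighbourhood of 1 in [G] reduced to 1. *)
have tZnd : ~ discrete_space (Topological.Pack tZ).
  move=> /discrete_nbhsP/(_ (1%g : center_type G)) [_ /= [[V oV <-] V1 Vi]].
  apply: tnd; apply: discrete_nbhs1 => //.
  have : nbhs (1%g : Topological.Pack t) V by exact: open_nbhs_nbhs.
  move=> /(filterI Zt); apply: filterS => g [Zg Vg].
  by have /(congr1 i) := Vi (SigSub (mem_set Zg)) Vg.
have [dZ|ndZ] := pselect (discrete_space (center_type G)).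
  (* A finite Hausdorff space is discrete. *)
  right; split=> // finZ; apply: tZnd => A.
  rewrite -(setCK A) openC.
  apply: (accessible_finite_set_closed.1 (hausdorff_accessible tZH)).
  exact: sub_finite_set finZ.
left; exists tZ; split => //.
- exact: group_topology_class.
- split=> //.
  exact: (@hausdorff_initial (center_type G) G i).
- apply: discrete_join => //; first exact: group_topology_class.
  have [A [B [A1 B1 AB]]] := join_nbhs_ex tauxt.
  exists (i @^-1` A), (i @^-1` B); split.
  + exact: (@initial_continuous (center_type G) G i 1%g).
  + exact: (@initial_continuous (center_type G) (Topological.Pack t) i 1%g).
  + by move=> z /AB z1; apply: iinj.
Qed.
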